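(* The sequence $\big(f(2p)\big)_{p=2}^{\infty}$ is convex.
   Context: For integers $m,l\geq 1$, the Eulerian number $A(m,l)$ is the number of permutations of $\{1,\ldots,m\}$ in which exactly $l-1$ elements are greater than the previous element. For $m\geq 1$ put $M_m=\max_{1\leq l\leq m}A(m,l)=A\big(m,\lfloor\frac{m}{2}\rfloor+1\big)$ and $f(m)=\frac{M_m}{m!}$. Equivalently, $f(m)=J_{m+1}(1)$ if $m$ is even and $f(m)=J_{m+1}(0)$ if $m$ is odd, where $J_n(r)=\frac{1}{\pi}\int_{-\infty}^{\infty}\operatorname{sinc}^n(t)\cos(rt)\,dt$ with $\operatorname{sinc}(x)=\frac{\sin x}{x}$ for $x\neq0$ and $\operatorname{sinc}(0)=1$. A sequence $(a_p)_{p\geq p_0}$ is convex if $a_{p-1}+a_{p+1}\geq 2a_p$ for all $p\geq p_0+1$. *)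

(* Defs.v *)
From HB Require Import structures.
From mathcomp Require Import all_boot all_order all_algebra all_fingroup.
From mathcomp Require Import reals.

Set Implicit Arguments.
Unset Strict Implicit.
Unset Printing Implicit Defensive.

Import Order.TTheory GRing.Theory Num.Theory.
Local Open Scope ring_scope.

(* A permutation s of {1, ..., m} is the word s 0, s 1, ..., s (m - 1) over
   'I_m; an ascent is recorded by the position i of the greater element,
   the previous element being at the position j with j + 1 = i. *)
Definition ascents (m : nat) (s : 'S_m) : {set 'I_m} :=
  [set i : 'I_m | [exists j : 'I_m, (j.+1 == i :> nat) && (s j < s i)%N]].

(* A(m, l) for l >= 1, where "exactly l - 1 ascents" is written without
   truncated subtraction. *)
Definition eulerian (m l : nat) : nat :=
  #|[set s : 'S_m | #|ascents s|.+1 == l]|.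

Definition max_eulerian (m : nat) : nat :=
  (\max_(1 <= l < m.+1) eulerian m l)%N.

Definition f (R : realType) (m : nat) : R :=
  (max_eulerian m)%:R / (m`!)%:R.

(* Convexity of the sequence (a p) for p >= p0; values below p0 are ignored. *)
Definition convex_seq (R : realType) (p0 : nat) (a : nat -> R) : Prop :=
  forall p : nat, (p0.+1 <= p)%N -> a p.-1 + a p.+1 >= 2 * a p.

(* Main.v *)
(** Write I_N(n, r) for the integral of sinc^n(t) cos(rt) over [0, N pi].  Since
    sin vanishes at N pi, integration by parts gives exactly
      m I_N(m+1, r) = (m+1+r)/2 I_N(m, r+1) + (m+1-r)/2 I_N(m, r-1),
    which for r = 2k-m-1 is the recurrence of A(m, k)/m!.  Together with
    I_N(2, 2k) -> 0 for k <> 0 this yields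
      I_N(m+1, 2k-m-1) - A(m, k)/m! I_N(2, 0) -> 0  as N -> oo,
    so neither Fourier inversion nor the value of the Dirichlet integral is needed.
    The second difference of f(2p) is thereby a positive multiple of the limit of
    the integrals of sinc^(2p-1)(t) cos t (1 - sinc^2 t)^2, whose integrand is
    nonnegative on [0, 3/2]: for large p the mass on [3/4, 1] beats the tail
    beyond 3/2.  The remaining small p are checked numerically. *)

From Stdlib Require Import Reals Lra Lia NArith.
From Coquelicot Require Import Coquelicot.
Require Import Defs.
From HB Require Import structures.
From mathcomp Require Import all_boot all_order all_algebra all_fingroup.
From mathcomp Require Import reals.
From mathcomp Require Import zify.

(** * Eulerian numbers: recurrence, symmetry and unimodality *)

Section Eulerian.
Local Open Scope nat_scope.

(** Row [0] sits at [k = 1]: the empty word has no ascent, and [k] counts ascents plus one. *)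
Fixpoint eul (m k : nat) : nat :=
  if m is m'.+1 then k * eul m' k + (m'.+2 - k) * eul m' k.-1 else k == 1.

(** [lift_perm i ord_max s] inserts the largest letter at position [i]. An old ascent survives
    unless the insertion separates its two letters, which happens exactly when [k = i]. *)
Lemma in_ascents_lift_perm m (i : 'I_m.+1) (s : 'S_m) (k : 'I_m) :
  (lift i k \in ascents (lift_perm i ord_max s))
  = (k \in ascents s) && (k != i :> nat).
Proof.
rewrite !inE; apply/existsP/andP => [[j /andP[/eqP jk]] | [/existsP[k' /andP[/eqP k'k sk]] ki]].
  rewrite lift_perm_lift; case: (unliftP i j) jk => [k' ->|->] jk.
    rewrite lift_perm_lift !lift_max => sk.
    have [k'k ki] : k'.+1 = k /\ k <> i :> nat.
      by move: jk; rewrite /= /bump; case: leqP; case: leqP; lia.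
    split; last exact/eqP.
    by apply/existsP; exists k'; rewrite k'k eqxx.
  by rewrite lift_perm_id lift_max /= ltnNge ltnW.
exists (lift i k'); rewrite !lift_perm_lift !lift_max sk andbT; apply/eqP.
by move: k'k ki => /= k'k /eqP ki; rewrite /= /bump; case: leqP; case: leqP; lia.
Qed.

Lemma in_ascents_lift_perm_max m (i : 'I_m.+1) (s : 'S_m) :
  (i \in ascents (lift_perm i ord_max s)) = (i != 0 :> nat).
Proof.
rewrite inE; apply/existsP/idP => [[j /andP[/eqP <- _]] //|i0].
have ji : i.-1 < m.+1 by have := ltn_ord i; lia.
exists (Ordinal ji); rewrite /= prednK ?lt0n // eqxx lift_perm_id /=.
rewrite ltn_neqAle -ltnS ltn_ord andbT.
apply/eqP => /(@ord_inj _ _ ord_max); rewrite -[in RHS](lift_perm_id i ord_max s).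
by move/perm_inj/(congr1 (@nat_of_ord _)) => /=; move/eqP: i0; lia.
Qed.

(** The insertion destroys at most the ascent recorded at [i], and creates one into the maximum
    unless the word now starts with it. *)
Lemma card_ascents_lift_perm m (i : 'I_m.+1) (s : 'S_m) :
  #|ascents (lift_perm i ord_max s)| + #|[set k in ascents s | k == i :> nat]|
  = #|ascents s| + (i != 0 :> nat).
Proof.
have cE (n : nat) (A : {set 'I_n}) : #|A| = \sum_k (k \in A) by rewrite -sum1_card big_mkcond.
rewrite !cE (bigD1_ord i) //= in_ascents_lift_perm_max -addnA addnC; congr (_ + _).
rewrite -big_split; apply: eq_bigr => k _ /=.
by rewrite in_ascents_lift_perm !inE; case: [exists _, _]; case: (_ == _).
Qed.

(* Inserting the new maximum just before the word or inside an ascent keeps the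
   number of ascents; at any other place it creates one. *)
Lemma sum_ascents_lift_perm m (s : 'S_m) (l : nat) :
  \sum_(i < m.+1) (#|ascents (lift_perm i ord_max s)|.+1 == l)
  = l * (#|ascents s|.+1 == l) + (m.+2 - l) * (#|ascents s|.+1 == l.-1).
Proof.
set a := #|ascents s|.
(* [u i] is [1] if inserting at [i] keeps the number of ascents and [0] otherwise. *)
pose u (i : 'I_m.+1) := (i == 0 :> nat) + #|[set k in ascents s | k == i :> nat]|.
have u1 i : u i <= 1.
  have c1 : #|[set k in ascents s | k == i :> nat]| <= 1.
    apply/card_le1_eqP => x y; rewrite !in_set => /andP[_ /eqP xi] /andP[_ /eqP yi].
    by apply: ord_inj; rewrite xi yi.
  rewrite /u; case: eqP => //= i0; rewrite (_ : [set _ in _ | _] = set0) ?cards0 //.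
  apply/setP => k; rewrite !in_set i0; apply/negP => /andP[/existsP[j /andP[/eqP jk _]] /eqP k0].
  by rewrite k0 in jk.
have au i : #|ascents (lift_perm i ord_max s)| + u i = a.+1.
  by rewrite /u addnCA card_ascents_lift_perm -/a; case: (_ == _); lia.
have su : \sum_i u i = a.+1.
  rewrite big_split /= (bigD1 ord0) //= big1 ?addn0; last first.
    by move=> i i0; case: eqP => // e; case/eqP: i0; apply: ord_inj.
  congr (_ + _); under eq_bigr => i _ do rewrite -sum1_card big_mkcond.
  rewrite exchange_big /a -sum1_card [RHS]big_mkcond /=; apply: eq_bigr => k _.
  rewrite (bigD1 (widen_ord (leqnSn m) k)) //= inE eqxx andbT big1 ?addn0 //.
  move=> i ik; rewrite inE; case: eqP => [e|]; last by rewrite andbF.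
  by case/eqP: ik; apply: ord_inj.
have su' : \sum_i (1 - u i) = m - a.
  have : \sum_i (u i + (1 - u i)) = m.+1.
    under eq_bigr => i _ do rewrite subnKC //.
    by rewrite sum1_card card_ord.
  by rewrite big_split /= su; lia.
transitivity (\sum_i (u i * (a.+1 == l) + (1 - u i) * (a.+1 == l.-1))).
  apply: eq_bigr => i _; have := au i; have := u1 i.
  case: (u i) => [|[|//]] _; rewrite ?addn0 ?addn1; first by move=> ->; case: l => [|l] /=; lia.
  by case=> ->; lia.
rewrite big_split /= -!big_distrl /= su su'; congr (_ + _).
  by case: eqP => [->|]; rewrite ?muln0.
by case: eqP => [e|]; rewrite ?muln0 //; lia.
Qed.

(** The position of the maximum recovers [p.1] and the other letters recover [p.2]; equal
    cardinalities do the rest. *)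
Lemma lift_perm_max_bij m :
  bijective (fun p : 'I_m.+1 * 'S_m => lift_perm p.1 ord_max p.2).
Proof.
apply: inj_card_bij => [[i s] [j t] /= E|].
  have ij : i = j.
    by apply: (@perm_inj _ (lift_perm i ord_max s)); rewrite {2}E !lift_perm_id.
  rewrite -ij in E *; congr (_, _); apply/permP => k.
  by apply: (@lift_inj _ ord_max); rewrite -(lift_perm_lift i) E lift_perm_lift.
by rewrite card_prod card_ord !card_Sn factS.
Qed.

Lemma eulerianE m l : eulerian m l = eul m l.
Proof.
have cE n k : eulerian n k = \sum_(s : 'S_n) (#|ascents s|.+1 == k).
  by rewrite /eulerian -sum1_card big_mkcond; apply: eq_bigr => s _; rewrite inE.
elim: m l => [|m IH] l.
  rewrite cE (eq_bigr (fun=> (l == 1) : nat)) => [|s _].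
    by rewrite sum_nat_const card_Sn mul1n.
  by rewrite (_ : ascents s = set0) ?cards0 1?eq_sym //; apply/setP => -[].
rewrite /= -!IH !cE (reindex _ (onW_bij _ (lift_perm_max_bij m))).
rewrite -(pair_bigA _ (fun i s => (#|ascents (lift_perm i ord_max s)|.+1 == l) : nat)).
rewrite exchange_big /= !big_distrr -big_split; apply: eq_bigr => s _.
exact: sum_ascents_lift_perm.
Qed.

(** * Symmetry and unimodality of the Eulerian triangle *)

Lemma eulS m k : eul m.+1 k = k * eul m k + (m.+2 - k) * eul m k.-1.
Proof. by []. Qed.

Lemma eul0 m : eul m 0 = 0.
Proof. by elim: m => // m IH; rewrite eulS IH !muln0. Qed.

Lemma eul_gt m k : m < k -> eul m.+1 k.+1 = 0.
Proof.
elim: m k => [|m IH] [|k] // mk; rewrite eulS.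
  by case: k mk => [|k] // _; rewrite !muln0.
by rewrite !IH ?muln0 //; lia.
Qed.

(** The reflection exchanges the two terms of the recurrence. *)
Lemma eul_sym m k : k <= m.+2 -> eul m.+1 (m.+2 - k) = eul m.+1 k.
Proof.
elim: m k => [|m IH] k km; first by case: k km => [|[|[|]]].
rewrite eulS (eulS m.+1 k) subKn // addnC.
have -> : (m.+3 - k).-1 = m.+2 - k by lia.
congr (_ * _ + _ * _).
  case: (ltngtP k m.+3) km => // kk _; first by rewrite IH.
  by rewrite kk eul_gt // (_ : m.+2 - m.+3 = 0) ?eul0 //; lia.
case: k km => [|k] km; first by rewrite subn0 eul_gt ?eul0.
by rewrite subSS IH.
Qed.

Lemma eul_incr m k : 2 * k.+1 <= m.+1 -> eul m k <= eul m k.+1.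
Proof.
elim: m k => [|m IH] k km; first lia.
case: k km => [|k] km; first by rewrite eul0.
rewrite !eulS /=.
have d1 : eul m k <= eul m k.+1 by apply: IH; lia.
have d2 : eul m k.+1 <= eul m k.+2.
  (* When [m] is twice [k + 1], the indices [k + 1] and [k + 2] are mirror images, and symmetry
     replaces the induction hypothesis. *)
  have [h|h] : 2 * k.+2 <= m.+1 \/ m = k.+1.*2 by lia.
    exact: IH.
  rewrite h doubleS -[X in _ <= X]eul_sym; last lia.
  by have -> : (k.*2.+3 - k.+2) = k.+1 by lia.
(* With [c = m.+2 - k.+2], right side minus left side is [(k + 2) (eul m k.+2 - eul m k.+1) + (c +
   1) (eul m k.+1 - eul m k)]. *)
have -> : m.+2 - k.+1 = (m.+2 - k.+2).+1 by lia.
have : m.+2 - k.+2 + k.+2 = m.+2 by lia.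
move: (m.+2 - k.+2) => c _; nia.
Qed.

Lemma max_eulerian_even p : 0 < p -> max_eulerian (2 * p) = eul (2 * p) p.+1.
Proof.
move=> p0.
have sym l : l <= (2 * p).+1 -> eul (2 * p) ((2 * p).+1 - l) = eul (2 * p) l.
  have -> : 2 * p = (2 * p).-1.+1 by lia.
  exact: eul_sym.
have up d l : l + d = p.+1 -> eul (2 * p) l <= eul (2 * p) p.+1.
  elim: d l => [|d IH] l ld; first by rewrite -ld addn0.
  (* The step from [p] to [p + 1] is an equality by symmetry; [eul_incr] climbs only up to [p]. *)
  case: d IH ld => [|d] IH ld.
    have -> : l = (2 * p).+1 - p.+1 by lia.
    by rewrite sym //; lia.
  apply: leq_trans (IH l.+1 _); [apply: eul_incr|]; lia.
apply/eqP; rewrite eqn_leq; apply/andP; split.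
  rewrite /max_eulerian big_nat; apply/bigmax_leqP_seq => l _ /andP[l1 lm].
  rewrite eulerianE; case: (leqP l p.+1) => lp; first by apply: (up (p.+1 - l)); lia.
  by rewrite -sym; [apply: (up (p.+1 - ((2 * p).+1 - l)))|]; lia.
rewrite -eulerianE; apply: (@leq_bigmax_seq _ _ _ (eulerian (2 * p))) => //.
by rewrite mem_index_iota; lia.
Qed.

End Eulerian.

(** * Truncated sinc integrals *)

Section SincIntegrals.
Local Open Scope R_scope.

Definition sinc (t : R) : R := if Req_EM_T t 0 then 1 else sin t / t.

Lemma sinc0 : sinc 0 = 1.
Proof. by rewrite /sinc; case: Req_EM_T. Qed.

Lemma sincE t : t <> 0 -> sinc t = sin t / t.
Proof. by rewrite /sinc; case: Req_EM_T. Qed.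

Lemma mul_sinc t : t * sinc t = sin t.
Proof.
case: (Req_EM_T t 0) => [->|t0]; first by rewrite sin_0 Rmult_0_l.
by rewrite sincE //; field.
Qed.

Lemma sinc_bounds t : 0 <= t <= 4 ->
  1 - t ^ 2 / 6 <= sinc t <= 1 - t ^ 2 / 6 + t ^ 4 / 120.
Proof.
move=> [t0 t4]; case: (Req_EM_T t 0) => [->|tn0]; first by rewrite sinc0; lra.
have tp : 0 < t by lra.
have := pre_sin_bound t 0 t0 t4.
rewrite /sin_approx /sin_term; cbn -[INR pow Factorial.fact].
have -> : INR (Factorial.fact 1) = 1 by rewrite INR_IZR_INZ.
have -> : INR (Factorial.fact 3) = 6 by rewrite INR_IZR_INZ.
have -> : INR (Factorial.fact 5) = 120 by rewrite INR_IZR_INZ.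
rewrite -(mul_sinc t) => H.
split; apply: (Rmult_le_reg_l t) => //; move: H => [lo hi]; lra.
Qed.

Lemma continuous_sinc t : continuous sinc t.
Proof.
case: (Req_EM_T t 0) => [->|t0].
  apply/continuity_pt_filterlim => eps eps0.
  (* [sinc] is the difference quotient of [sin] at [0]. *)
  have [d Hd] := derivable_pt_lim_sin_0 eps eps0.
  exists (pos d); split; first exact: cond_pos.
  move=> x [[_ x0] xd].
  have {}x0 : x <> 0 by move=> e; apply: x0; rewrite e.
  rewrite /= /Rdist sinc0 sincE //.
  move: (Hd x x0); rewrite Rplus_0_l sin_0 Rminus_0_r; apply.
  by move: xd; rewrite /= /Rdist Rminus_0_r.
apply: (continuous_ext_loc _ (fun x => sin x / x)).
  have := open_neq 0 t t0; apply: filter_imp => x x0.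
  by rewrite sincE.
apply: ex_derive_continuous; auto_derive; exact: t0.
Qed.

Lemma continuous_sinc_pow_cos n r t :
  continuous (fun t => sinc t ^ n * cos (r * t)) t.
Proof.
apply: (continuous_mult (fun t => sinc t ^ n)).
  elim: n => [|n IH] /=; first exact: continuous_const.
  by apply: (continuous_mult sinc) => //; exact: continuous_sinc.
by apply: ex_derive_continuous; auto_derive.
Qed.

(** * Integration by parts for the truncated integrals *)

Lemma sin_INR_PI N : sin (INR N * PI) = 0.
Proof. by apply: sin_eq_0_1; exists (Z.of_nat N); rewrite -INR_IZR_INZ. Qed.

(* Truncating at a zero of [sin] makes the boundary terms of the integration by parts vanish. *)
Definition sinc_int (N n : nat) (r : R) : R :=
  RInt (fun t => sinc t ^ n * cos (r * t)) 0 (INR N * PI).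

Lemma ex_RInt_sinc_pow_cos n r a b :
  ex_RInt (fun t => sinc t ^ n * cos (r * t)) a b.
Proof. by apply: ex_RInt_continuous => z _; exact: continuous_sinc_pow_cos. Qed.

Lemma sinc_intN N n r : sinc_int N n (- r) = sinc_int N n r.
Proof.
apply: RInt_ext => x _.
by rewrite Ropp_mult_distr_l_reverse cos_neg.
Qed.

(** Away from [0] the function is [sin^(m+1) cos(rt) / t^m]; the addition formulas turn its
    derivative into cosines of frequencies [r + 1] and [r - 1]. *)
Lemma is_derive_sinc_pow_cos m r t :
  is_derive (fun t => t * (sinc t ^ (S m) * cos (r * t))) t
    (- INR m * (sinc t ^ (S m) * cos (r * t))
     + ((INR m + 1 + r) / 2 * (sinc t ^ m * cos ((r + 1) * t))
     + (INR m + 1 - r) / 2 * (sinc t ^ m * cos ((r - 1) * t)))).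
Proof.
case: (Req_EM_T t 0) => [->|t0].
  have c := continuous_sinc_pow_cos (S m) r 0.
  have -> : (- INR m * (sinc 0 ^ (S m) * cos (r * 0))
     + ((INR m + 1 + r) / 2 * (sinc 0 ^ m * cos ((r + 1) * 0))
     + (INR m + 1 - r) / 2 * (sinc 0 ^ m * cos ((r - 1) * 0)))) = 1.
    rewrite sinc0 !pow1 !Rmult_0_r cos_0; field.
  (* At [0] the difference quotient is [sinc^(m+1) cos(rt)] itself, so its continuity suffices. *)
  apply/is_derive_Reals => eps eps0.
  move/continuity_pt_filterlim: c => c.
  have [d [d0 Hd]] := c eps eps0.
  exists (mkposreal d d0) => h h0 hd.
  have := Hd h; rewrite /= /Rdist /D_x /no_cond sinc0 !Rmult_0_r cos_0 Rplus_0_l.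
  rewrite pow1 !Rmult_1_r !Rminus_0_r => H.
  have -> : h * (sinc h * sinc h ^ m * cos (r * h)) / h
    = sinc h * sinc h ^ m * cos (r * h) by field.
  by apply: H; split=> //; split=> // e; apply: h0.
have E (x : R) : x <> 0 -> sin x ^ S m * cos (r * x) / x ^ m =
    x * (sinc x ^ S m * cos (r * x)).
  by move=> x0; rewrite sincE // /Rdiv Rpow_mult_distr pow_inv /=; field;
    split => //; apply: pow_nonzero.
apply: (is_derive_ext_loc (fun x => sin x ^ S m * cos (r * x) / x ^ m)).
  have := open_neq 0 t t0; apply: filter_imp => x x0; exact: E.
have tm : t ^ m <> 0 by apply: pow_nonzero.
auto_derive; first by [].
have -> : cos ((r + 1) * t) = cos (r * t) * cos t - sin (r * t) * sin t.
  by rewrite -cos_plus; congr cos; ring.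
have -> : cos ((r - 1) * t) = cos (r * t) * cos t + sin (r * t) * sin t.
  by rewrite -cos_minus; congr cos; ring.
rewrite sincE // /Rdiv !Rpow_mult_distr !pow_inv.
case: m E tm => [|m] E tm; rewrite /=.
  by field.
have tm' : t ^ m <> 0 by apply: pow_nonzero.
by field; split.
Qed.

Lemma sinc_int_rec N m r :
  INR m * sinc_int N (S m) r =
  (INR m + 1 + r) / 2 * sinc_int N m (r + 1)
  + (INR m + 1 - r) / 2 * sinc_int N m (r - 1).
Proof.
set a := (INR m + 1 + r) / 2; set b := (INR m + 1 - r) / 2.
pose g n r := fun t => sinc t ^ n * cos (r * t).
have ex n s : ex_RInt (g n s) 0 (INR N * PI) by apply: ex_RInt_sinc_pow_cos.
have sc c n s : ex_RInt (fun t => scal c (g n s t)) 0 (INR N * PI).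
  exact: ex_RInt_scal.
have H : RInt (fun t => plus (scal (- INR m) (g (S m) r t))
    (plus (scal a (g m (r + 1) t)) (scal b (g m (r - 1) t)))) 0 (INR N * PI) = 0.
  rewrite (is_RInt_unique _ _ _ _
    (is_RInt_derive (fun t => t * g (S m) r t) _ _ _ _ _)); first last.
  - move=> x _.
    have c k n s : continuous (fun t => scal k (g n s t)) x.
      by apply: continuous_scal_r; exact: continuous_sinc_pow_cos.
    by apply: continuous_plus => //; apply: continuous_plus.
  - by move=> x _; exact: is_derive_sinc_pow_cos.
  have -> : INR N * PI * g (S m) r (INR N * PI) = 0.
    move: (sin_INR_PI N); set T := INR N * PI => sT.
    by rewrite /g /= -!Rmult_assoc mul_sinc sT; ring.
  by rewrite /minus /plus /Hierarchy.opp /=; ring.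
move: H.
rewrite RInt_plus //; last exact: ex_RInt_plus.
rewrite RInt_plus // !RInt_scal // /plus /scal /= /mult /= -/(sinc_int N (S m) r).
rewrite -/(sinc_int N m (r + 1)) -/(sinc_int N m (r - 1)); lra.
Qed.

(** * Integrals of [sinc^2] at even frequencies *)

Lemma RInt_inv_sq a b : 0 < a -> a <= b ->
  ex_RInt (fun t => / t ^ 2) a b /\ RInt (fun t => / t ^ 2) a b = / a - / b.
Proof.
move=> a0 ab.
have H : is_RInt (fun t => / t ^ 2) a b (minus (- / b) (- / a)).
  apply: (is_RInt_derive (fun t => - / t)) => x;
    rewrite Rmin_left // => -[ax _]; have x0 : x <> 0 by lra.
    by auto_derive => //; field.
  by apply: ex_derive_continuous; auto_derive; exact: (pow_nonzero x 2).
split; first by exists (minus (- / b) (- / a)).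
by rewrite (is_RInt_unique _ _ _ _ H) /minus /plus /Hierarchy.opp /=; ring.
Qed.

Lemma sinc_sq_le t : 0 < t -> sinc t ^ 2 <= / t ^ 2.
Proof.
move=> t0; apply: (Rmult_le_reg_l (t ^ 2)); first by nra.
rewrite Rinv_r; last by nra.
have := SIN_bound t; rewrite -(mul_sinc t); nra.
Qed.

Lemma is_lim_seq_inv_INR : is_lim_seq (fun N => / INR N) 0.
Proof. exact: (is_lim_seq_inv _ _ is_lim_seq_INR). Qed.

(** On the added interval the integrand lies between [0] and [1/t^2]. *)
Lemma sinc_sq_int_tail N j :
  0 <= sinc_int (S j * S N) 2 0 - sinc_int (S N) 2 0 <= / INR (S N).
Proof.
have pi0 := PI2_3_2.
have n1 : 1 <= INR (S N) by rewrite S_INR; have := pos_INR N; lra.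
have j1 : 1 <= INR (S j) by rewrite S_INR; have := pos_INR j; lra.
have le : INR (S N) * PI <= INR (S j * S N) * PI by rewrite mult_INR; apply: Rmult_le_compat_r; [lra | nra].
rewrite /sinc_int.
rewrite -(RInt_Chasles _ 0 (INR (S N) * PI) (INR (S j * S N) * PI));
  [| exact: ex_RInt_sinc_pow_cos | exact: ex_RInt_sinc_pow_cos].
move: n1 le; set a := INR (S N); set b := INR (S j * S N) => n1 le.
have a0 : 0 < a * PI by nra.
have [ex e] := RInt_inv_sq _ _ a0 le.
rewrite /plus /= Rplus_comm; set I1 := RInt _ 0 _; set I2 := RInt _ _ _.
have -> : I2 + I1 - I1 = I2 by ring.
split.
  apply: RInt_ge_0 => //; first exact: (ex_RInt_sinc_pow_cos 2).
  by move=> x _; rewrite Rmult_0_l cos_0; nra.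
apply: Rle_trans (_ : / (a * PI) - / (b * PI) <= _); last first.
  have : 0 < / (b * PI) by apply: Rinv_0_lt_compat; lra.
  have : / (a * PI) <= / a by apply: Rinv_le_contravar; nra.
  lra.
rewrite -e; apply: RInt_le => //; first exact: (ex_RInt_sinc_pow_cos 2).
move=> x [ax _]; rewrite Rmult_0_l cos_0 Rmult_1_r.
by apply: sinc_sq_le; lra.
Qed.

(** Substituting [u = jt] absorbs one factor [j], and the endpoint stays a multiple of [PI]. *)
Lemma sinc_sq_int_dilate N j :
  RInt (fun t => (INR j * sinc (INR j * t)) ^ 2) 0 (INR N * PI)
  = INR j * sinc_int (j * N) 2 0.
Proof.
have -> : sinc_int (j * N) 2 0
    = RInt (fun t => sinc t ^ 2 * cos (0 * t)) (INR j * 0 + 0) (INR j * (INR N * PI) + 0).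
  by rewrite Rmult_0_r !Rplus_0_r -Rmult_assoc -mult_INR.
rewrite -RInt_comp_lin; last exact: ex_RInt_sinc_pow_cos.
pose h t := scal (INR j) (sinc (INR j * t + 0) ^ 2 * cos (0 * (INR j * t + 0))).
transitivity (RInt (fun t => scal (INR j) (h t)) 0 (INR N * PI)).
  apply: RInt_ext => x _.
  by rewrite /h /scal /= /mult /= Rmult_0_l cos_0 Rplus_0_r; ring.
apply: RInt_scal.
apply: (ex_RInt_comp_lin (fun t => sinc t ^ 2 * cos (0 * t))).
exact: ex_RInt_sinc_pow_cos.
Qed.

(* [sin^2 t cos (2jt)] is half the second difference in [j] of [sin^2 (jt)]. *)
Lemma sinc_sq_cos i t : sinc t ^ 2 * cos (2 * INR (S i) * t) =
  (1 / 2) * ((INR (S (S i)) * sinc (INR (S (S i)) * t)) ^ 2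
   + (INR i * sinc (INR i * t)) ^ 2 - 2 * (INR (S i) * sinc (INR (S i) * t)) ^ 2).
Proof.
rewrite !S_INR; set j := INR i.
case: (Req_EM_T t 0) => [->|t0].
  by rewrite !Rmult_0_r cos_0 !sinc0; field.
apply: (Rmult_eq_reg_l (t ^ 2)); last by apply: pow_nonzero.
have E (x : R) : t ^ 2 * (x * sinc (x * t)) ^ 2 = sin (x * t) ^ 2.
  by rewrite -(mul_sinc (x * t)); ring.
have -> : t ^ 2 * (sinc t ^ 2 * cos (2 * (j + 1) * t)) =
    sin t ^ 2 * cos (2 * ((j + 1) * t)).
  by rewrite -(mul_sinc t) -(Rmult_assoc 2); ring.
transitivity (1 / 2 * (t ^ 2 * ((j + 1 + 1) * sinc ((j + 1 + 1) * t)) ^ 2 +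
  t ^ 2 * (j * sinc (j * t)) ^ 2 - 2 * (t ^ 2 * ((j + 1) * sinc ((j + 1) * t)) ^ 2)));
  last by ring.
rewrite !E cos_2a_sin.
have -> : (j + 1 + 1) * t = (j + 1) * t + t by ring.
have -> : j * t = (j + 1) * t - t by ring.
rewrite sin_plus sin_minus; set x := (j + 1) * t.
have := sin2_cos2 t; have := sin2_cos2 x; rewrite /Rsqr => ex et.
have cx : cos x ^ 2 = 1 - sin x ^ 2 by lra.
have ct : cos t ^ 2 = 1 - sin t ^ 2 by lra.
have -> : 1 / 2 * ((sin x * cos t + cos x * sin t) ^ 2 +
    (sin x * cos t - cos x * sin t) ^ 2 - 2 * sin x ^ 2)
  = sin x ^ 2 * cos t ^ 2 + cos x ^ 2 * sin t ^ 2 - sin x ^ 2 by field.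
by rewrite cx ct; ring.
Qed.

(** The weights [i + 2], [i] and [-2 (i + 1)] sum to [0], so [sinc_int N 2 0] can be subtracted from
    each integral, leaving only differences that tend to [0]. *)
Lemma sinc_sq_int_second_diff N i : sinc_int N 2 (2 * INR (S i)) =
  1 / 2 * (INR (S (S i)) * (sinc_int (S (S i) * N) 2 0 - sinc_int N 2 0)
    + INR i * (sinc_int (i * N) 2 0 - sinc_int N 2 0)
    - 2 * (INR (S i) * (sinc_int (S i * N) 2 0 - sinc_int N 2 0))).
Proof.
pose h j := fun t => (INR j * sinc (INR j * t)) ^ 2.
have exh j : ex_RInt (h j) 0 (INR N * PI).
  apply: ex_RInt_continuous => z _.
  apply: (continuous_comp (fun t => INR j * sinc (INR j * t)) (fun y => y ^ 2)); last first.
    by apply: ex_derive_continuous; auto_derive.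
  apply: (continuous_scal_r (INR j) (fun t => sinc (INR j * t))).
  apply: (continuous_comp (fun t => INR j * t) sinc); last exact: continuous_sinc.
  by apply: ex_derive_continuous; auto_derive.
have -> : sinc_int N 2 (2 * INR (S i)) = RInt (fun t =>
    scal (1 / 2) (plus (plus (h (S (S i)) t) (h i t)) (scal (- 2) (h (S i) t)))) 0 (INR N * PI).
  apply: RInt_ext => x _; rewrite sinc_sq_cos /h /scal /plus /= /mult /=; ring.
have exs c j : ex_RInt (fun t => scal c (h j t)) 0 (INR N * PI) by apply: ex_RInt_scal.
have ex2 : ex_RInt (fun t => plus (h (S (S i)) t) (h i t)) 0 (INR N * PI).
  exact: ex_RInt_plus.
rewrite RInt_scal; last exact: ex_RInt_plus.
rewrite RInt_plus // RInt_plus // RInt_scal //.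
rewrite /h !sinc_sq_int_dilate /scal /plus /= /mult /= -/(INR (S i)) -/(INR (S (S i))).
rewrite !S_INR; ring.
Qed.

Lemma is_lim_seq_sinc_sq_int_dilate j :
  is_lim_seq (fun N => INR j * (sinc_int (j * N) 2 0 - sinc_int N 2 0)) 0.
Proof.
case: j => [|j].
  apply: (is_lim_seq_ext (fun=> 0)); last exact: is_lim_seq_const.
  by move=> N; rewrite /= Rmult_0_l.
have -> : (0 : Rbar) = Rbar_mult (INR (S j)) 0 by rewrite /= Rmult_0_r.
apply: is_lim_seq_scal_l; apply/is_lim_seq_incr_1.
apply: (is_lim_seq_le_le (fun=> 0) _ (fun N => / INR (S N))).
- by move=> N; exact: sinc_sq_int_tail.
- exact: is_lim_seq_const.
- by apply/(is_lim_seq_incr_1 (fun N => / INR N)); exact: is_lim_seq_inv_INR.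
Qed.

(** The Fourier transform of [sinc^2] is a triangle supported on [[-2, 2]]; its zeros at even
    frequencies start the induction on Eulerian rows. *)
Lemma is_lim_seq_sinc_sq_int i :
  is_lim_seq (fun N => sinc_int N 2 (2 * INR (S i))) 0.
Proof.
apply: (is_lim_seq_ext _ _ _ (fun N => esym (sinc_sq_int_second_diff N i))).
have e : 1 / 2 * (0 + 0 - 2 * 0) = 0 by ring.
rewrite -[X in is_lim_seq _ (Rbar.Finite X)]e.
apply: (is_lim_seq_scal_l _ (1 / 2) (Rbar.Finite (0 + 0 - 2 * 0))).
apply: is_lim_seq_minus'.
  by apply: is_lim_seq_plus'; exact: is_lim_seq_sinc_sq_int_dilate.
apply: (is_lim_seq_scal_l _ 2 (Rbar.Finite 0)); exact: is_lim_seq_sinc_sq_int_dilate.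
Qed.

(** A positive lower bound independent of the truncation is enough to read off a sign in the
    limit. *)
Lemma sinc_sq_int_gt0 N : sinc_int 1 2 0 <= sinc_int (S N) 2 0 /\ 0 < sinc_int 1 2 0.
Proof.
split; first by have := sinc_sq_int_tail 0 N; rewrite muln1; lra.
have pi0 := PI2_3_2.
rewrite /sinc_int -(RInt_Chasles _ 0 1); try exact: ex_RInt_sinc_pow_cos.
rewrite /plus /= Rplus_comm; apply: Rplus_le_lt_0_compat.
  apply: RInt_ge_0; [lra | exact: (ex_RInt_sinc_pow_cos 2) |].
  by move=> x _; rewrite Rmult_0_l cos_0; nra.
apply: RInt_gt_0; first lra.
  move=> x [x0 x1]; rewrite Rmult_0_l cos_0.
  have [|lo _] := sinc_bounds x; first lra.
  have : 0 < sinc x by nra.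
  nra.
by move=> x _; exact: (continuous_sinc_pow_cos 2).
Qed.

(** * Sign of the weighted integral for large exponents *)

Definition sinc_weight n t := sinc t ^ n * cos (1 * t) * (1 - sinc t ^ 2) ^ 2.

Lemma continuous_sinc_weight n t : continuous (sinc_weight n) t.
Proof.
apply: (continuous_mult (fun t => sinc t ^ n * cos (1 * t)) (fun t => (1 - sinc t ^ 2) ^ 2)).
  exact: continuous_sinc_pow_cos.
apply: (continuous_comp sinc (fun y => (1 - y ^ 2) ^ 2)); first exact: continuous_sinc.
by apply: ex_derive_continuous; auto_derive.
Qed.

Lemma ex_RInt_sinc_weight n a b : ex_RInt (sinc_weight n) a b.
Proof. by apply: ex_RInt_continuous => z _; exact: continuous_sinc_weight. Qed.

Lemma sinc_weight_ge0 n t : 0 <= t <= 3 / 2 -> 0 <= sinc_weight n t.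
Proof.
move=> [t0 t1]; have := PI2_3_2 => pi0.
apply: Rmult_le_pos; last exact: pow2_ge_0.
apply: Rmult_le_pos; last by apply: cos_ge_0; lra.
by apply: pow_le; have := sinc_bounds t; nra.
Qed.

(** Here [5/6 <= sinc t <= 91/100] and [cos t >= 1/2], so [1 - sinc^2 >= 17/100]; the constant is
    [(1/2) (17/100)^2]. *)
Lemma sinc_weight_ge n t : 3 / 4 <= t <= 1 -> (5 / 6) ^ n * (289 / 20000) <= sinc_weight n t.
Proof.
move=> [t0 t1].
have [lo hi] : 5 / 6 <= sinc t <= 91 / 100.
  have [] : 1 - t ^ 2 / 6 <= sinc t <= 1 - t ^ 2 / 6 + t ^ 4 / 120 by apply: sinc_bounds; lra.
  have : 9 / 16 <= t ^ 2 <= 1 by nra.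
  have -> : t ^ 4 = t ^ 2 * t ^ 2 by ring.
  move: (t ^ 2) => u; nra.
have p0 : 0 < (5 / 6) ^ n by apply: pow_lt; lra.
have p1 : (5 / 6) ^ n <= sinc t ^ n by apply: pow_incr; lra.
have c : 1 / 2 <= cos (1 * t).
  have -> : 1 * t = 2 * (t / 2) by field.
  rewrite cos_2a_sin.
  have : sin (t / 2) < t / 2 by apply: sin_lt_x; lra.
  have : 0 <= sin (t / 2) by apply: sin_ge_0; have := PI2_3_2; lra.
  nra.
have w : 17 / 100 <= 1 - sinc t ^ 2 by nra.
have w2 : 289 / 10000 <= (1 - sinc t ^ 2) ^ 2 by nra.
rewrite /sinc_weight.
have -> : (5 / 6) ^ n * (289 / 20000) = (5 / 6) ^ n * (1 / 2) * (289 / 10000) by field.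
apply: Rmult_le_compat; [nra | lra | | lra].
by apply: Rmult_le_compat; lra.
Qed.

(** Each of [n] factors satisfies [|sinc t| <= 1/t <= 2/3]; the other two supply the integrable
    [1/t^2]. *)
Lemma sinc_weight_tail n t : 3 / 2 <= t ->
  - ((2 / 3) ^ n * / t ^ 2) <= sinc_weight (n + 2) t.
Proof.
move=> t0.
have tp : 0 < t by lra.
have s2 := sinc_sq_le t tp.
have s1 : Rabs (sinc t) <= 2 / 3.
  apply: (Rmult_le_reg_l t) => //.
  rewrite -{1}(Rabs_pos_eq t); last lra.
  rewrite -Rabs_mult mul_sinc.
  have := SIN_bound t => sb.
  have : Rabs (sin t) <= 1 by apply: Rabs_le; lra.
  nra.
have sn : Rabs (sinc t ^ n) <= (2 / 3) ^ n.
  by rewrite -RPow_abs; apply: pow_incr; split=> //; exact: Rabs_pos.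
have w : 0 <= (1 - sinc t ^ 2) ^ 2 <= 1.
  have : sinc t ^ 2 <= 1 by apply: (Rle_trans _ _ _ s2); rewrite -Rinv_1; apply: Rinv_le_contravar; nra.
  have : 0 <= sinc t ^ 2 by nra.
  move: (sinc t ^ 2) => u; nra.
have c : Rabs (cos (1 * t)) <= 1 by apply: Rabs_le; have := COS_bound (1 * t); lra.
suff : Rabs (sinc_weight (n + 2) t) <= (2 / 3) ^ n * / t ^ 2.
  by move=> H; have := Rle_abs (- sinc_weight (n + 2) t); rewrite Rabs_Ropp; lra.
rewrite /sinc_weight pow_add Rabs_mult (Rabs_mult (_ * sinc t ^ 2)) (Rabs_mult (sinc t ^ n)).
rewrite (Rabs_pos_eq (sinc t ^ 2)); last by nra.
rewrite (Rabs_pos_eq ((1 - sinc t ^ 2) ^ 2)); last by lra.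
have i0 : 0 <= / t ^ 2 by apply/Rlt_le/Rinv_0_lt_compat; nra.
have q0 : 0 <= (2 / 3) ^ n by apply: pow_le; lra.
have -> : (2 / 3) ^ n * / t ^ 2 = (2 / 3) ^ n * / t ^ 2 * 1 * 1 by ring.
have a0 := Rabs_pos (sinc t ^ n); have b0 := Rabs_pos (cos (1 * t)).
have s0 : 0 <= sinc t ^ 2 by nra.
apply: Rmult_le_compat; [ by apply: Rmult_le_pos; first apply: Rmult_le_pos | lra | | lra].
apply: Rmult_le_compat => //; first exact: Rmult_le_pos.
exact: Rmult_le_compat.
Qed.

(* The mass on [[3/4, 1]] is of order [(5/6)^n], the tail beyond [3/2] of order [(2/3)^n]. *)
Lemma RInt_sinc_weight_ge0 n T : 3 / 2 <= T -> 0 <= RInt (sinc_weight (n + 28)) 0 T.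
Proof.
move=> T0.
have ex a b := ex_RInt_sinc_weight (n + 28) a b.
rewrite -(RInt_Chasles _ 0 (3 / 4)) // -(RInt_Chasles _ (3 / 4) 1) //
  -(RInt_Chasles _ 1 (3 / 2)) // /plus /=.
have I1 : 0 <= RInt (sinc_weight (n + 28)) 0 (3 / 4).
  apply: RInt_ge_0; [lra | exact: ex | move=> x x01; apply: sinc_weight_ge0; lra].
have I3 : 0 <= RInt (sinc_weight (n + 28)) 1 (3 / 2).
  apply: RInt_ge_0; [lra | exact: ex | move=> x x01; apply: sinc_weight_ge0; lra].
have I2 : (1 / 4) * ((5 / 6) ^ (n + 28) * (289 / 20000)) <= RInt (sinc_weight (n + 28)) (3 / 4) 1.
  have -> : 1 / 4 * ((5 / 6) ^ (n + 28) * (289 / 20000)) =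
      RInt (fun=> (5 / 6) ^ (n + 28) * (289 / 20000)) (3 / 4) 1.
    rewrite RInt_const /scal /= /mult /=; field.
  apply: RInt_le; [lra | exact: ex_RInt_const | exact: ex |].
  by move=> x x01; apply: sinc_weight_ge; lra.
(* The last factor [2/3] is the integral of [1/t^2] over [[3/2, oo)]. *)
have I4 : - ((2 / 3) ^ (n + 26) * (2 / 3)) <= RInt (sinc_weight (n + 28)) (3 / 2) T.
  have [] := RInt_inv_sq (3 / 2) T _ T0; first lra.
  move=> exi ei.
  apply: (Rle_trans _ (RInt (fun t => scal (- (2 / 3) ^ (n + 26)) (/ t ^ 2)) (3 / 2) T)).
    rewrite RInt_scal // ei /scal /= /mult /=.
    have : 0 < / T by apply: Rinv_0_lt_compat; lra.
    have : 0 < (2 / 3) ^ (n + 26) by apply: pow_lt; lra.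
    have -> : / (3 / 2) = 2 / 3 by field.
    nra.
  apply: RInt_le => //; [exact: ex_RInt_scal | move=> x x01].
  have -> : (n + 28)%N = (n + 26 + 2)%N by rewrite -addnA.
  have := sinc_weight_tail (n + 26) x.
  rewrite /scal /= /mult /=; lra.
have e : (5 / 6) ^ (n + 28) = (5 / 4) ^ (n + 28) * (2 / 3) ^ (n + 28).
  by rewrite -Rpow_mult_distr; congr (_ ^ _); field.
have e2 : (2 / 3) ^ (n + 28) = (2 / 3) ^ (n + 26) * (2 / 3) * (2 / 3).
  have -> : (n + 28)%N = (n + 26 + 2)%N by rewrite -addnA.
  by rewrite pow_add; ring.
have p0 : 0 < (2 / 3) ^ (n + 26) by apply: pow_lt; lra.
(* The comparison needs [(5/4)^(n+28) >= 6 * 20000 / 289], about 415; already for [n = 0] the power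
   is about 517, and [28] is the least such exponent. *)
have big : 500 <= (5 / 4) ^ (n + 28).
  rewrite pow_add; have : 1 <= (5 / 4) ^ n by apply: pow_R1_Rle; lra.
  have : 500 <= (5 / 4) ^ 28 by lra.
  nra.
rewrite e e2 in I2; nra.
Qed.

(** [sinc^n - 2 sinc^(n+2) + sinc^(n+4) = sinc^n (1 - sinc^2)^2]. *)
Lemma sinc_int_second_diff N n : sinc_int N n 1 + sinc_int N (n + 4) 1 - 2 * sinc_int N (n + 2) 1
  = RInt (sinc_weight n) 0 (INR N * PI).
Proof.
pose g k := fun t => sinc t ^ k * cos (1 * t).
have ex k : ex_RInt (g k) 0 (INR N * PI) by exact: ex_RInt_sinc_pow_cos.
have -> : RInt (sinc_weight n) 0 (INR N * PI) = RInt (fun t =>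
    plus (plus (g n t) (g (n + 4)%N t)) (scal (- 2) (g (n + 2)%N t))) 0 (INR N * PI).
  apply: RInt_ext => x _; rewrite /sinc_weight /g /scal /plus /= /mult /= !pow_add; ring.
rewrite RInt_plus; [| exact: ex_RInt_plus | exact: ex_RInt_scal].
rewrite RInt_plus // RInt_scal // /plus /scal /= /mult /= /sinc_int /g; ring.
Qed.

End SincIntegrals.

(** * Convexity *)

Section EulerianSinc.
Local Open Scope R_scope.

Lemma is_lim_seq_sinc_int m k :
  is_lim_seq (fun N => sinc_int N (S (S m)) (2 * INR k - INR m - 2)
    - INR (eul (S m) k) / INR (S m)`! * sinc_int N 2 0) 0.
Proof.
elim: m k => [|m IH] k.
  have e1 : INR 1`! = 1 by [].
  rewrite e1; case: k => [|[|k]].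
  - apply: (is_lim_seq_ext _ _ _ _ (is_lim_seq_sinc_sq_int 0)) => N.
    rewrite eul0 -sinc_intN.
    have -> : - (2 * INR 1) = 2 * INR 0 - INR 0 - 2 by rewrite /=; ring.
    by rewrite /=; field.
  - apply: (is_lim_seq_ext (fun=> 0)); last exact: is_lim_seq_const.
    move=> N; have -> : 2 * INR 1 - INR 0 - 2 = 0 by rewrite /=; ring.
    by rewrite (_ : eul 1 1 = 1%N) //=; field.
  - apply: (is_lim_seq_ext _ _ _ _ (is_lim_seq_sinc_sq_int k)) => N.
    have -> : 2 * INR (S (S k)) - INR 0 - 2 = 2 * INR (S k) by rewrite !S_INR /=; ring.
    by rewrite eul_gt //=; field.
have m0 := pos_INR m; have m1 := S_INR m; have m2 := S_INR (S m).
have f0 : INR (S m)`! <> 0 by apply: not_0_INR; have := fact_gt0 m.+1; lia.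
(* The case [k = 0] has no predecessor for the recurrence; evenness in the frequency sends it to
   [k = m + 3], where [eul] also vanishes. *)
suff H j : is_lim_seq (fun N => sinc_int N (S (S (S m))) (2 * INR (S j) - INR (S m) - 2)
    - INR (eul (S (S m)) (S j)) / INR (S (S m))`! * sinc_int N 2 0) 0.
  case: k => [|k]; last exact: H.
  apply: (is_lim_seq_ext _ _ _ _ (H (S (S m)))) => N.
  rewrite eul_gt // eul0 -sinc_intN; congr (sinc_int _ _ _ - _).
  by rewrite !S_INR /=; ring.
have C : INR (eul (S (S m)) (S j)) / INR (S (S m))`! =
    INR (S j) / INR (S (S m)) * (INR (eul (S m) (S j)) / INR (S m)`!)
    + (INR m + 2 - INR j) / INR (S (S m)) * (INR (eul (S m) j) / INR (S m)`!).
  rewrite eulS [(S (S m))`!]factS [(S j).-1]/=.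
  move: ((S m)`!) f0 => F F0; rewrite plus_INR !mult_INR.
  (* Where the subtraction truncates wrongly, [j > m + 2], the factor [eul (S m) j] is [0]. *)
  have -> : INR (m.+3 - j.+1) * INR (eul (S m) j)
      = (INR m + 2 - INR j) * INR (eul (S m) j).
    case: (leqP j m.+2) => jm.
      by rewrite minus_INR ?m2 ?m1 ?S_INR; [ring | lia].
    by case: j jm => // j jm; rewrite eul_gt /=; [ring | lia].
  have k1 : INR (S m) <> 0 by lra.
  have k2 : INR (S (S m)) <> 0 by lra.
  by field.
apply: (is_lim_seq_ext (fun N =>
    INR (S j) / INR (S (S m)) * (sinc_int N (S (S m)) (2 * INR (S j) - INR m - 2)
       - INR (eul (S m) (S j)) / INR (S m)`! * sinc_int N 2 0)
  + (INR m + 2 - INR j) / INR (S (S m)) * (sinc_int N (S (S m)) (2 * INR j - INR m - 2)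
       - INR (eul (S m) j) / INR (S m)`! * sinc_int N 2 0))).
  move=> N.
  (* At this frequency the coefficients are [j + 1] and [m + 2 - j]. *)
  have := sinc_int_rec N (S (S m)) (2 * INR (S j) - INR (S m) - 2).
  have -> : 2 * INR (S j) - INR (S m) - 2 + 1 = 2 * INR (S j) - INR m - 2 by lra.
  have -> : 2 * INR (S j) - INR (S m) - 2 - 1 = 2 * INR j - INR m - 2.
    by rewrite (S_INR j); lra.
  set s3 := sinc_int N (S (S (S m))) _; set s2 := sinc_int N (S (S m)) _.
  set s1 := sinc_int N (S (S m)) _ => rec.
  have -> : s3 = INR (S j) / INR (S (S m)) * s2 + (INR m + 2 - INR j) / INR (S (S m)) * s1.
    apply: (Rmult_eq_reg_l (INR (S (S m)))); last lra.
    rewrite rec (S_INR j) m2 m1; field; lra.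
  by rewrite C; ring.
rewrite -[X in is_lim_seq _ (Rbar.Finite X)](Rplus_0_r 0).
apply: is_lim_seq_plus'.
  by rewrite -[X in is_lim_seq _ (Rbar.Finite X)](Rmult_0_r (INR (S j) / INR (S (S m))));
    exact: (is_lim_seq_scal_l _ _ (Rbar.Finite 0)).
by rewrite -[X in is_lim_seq _ (Rbar.Finite X)](Rmult_0_r ((INR m + 2 - INR j) / INR (S (S m))));
  exact: (is_lim_seq_scal_l _ _ (Rbar.Finite 0)).
Qed.

(** For [p > 0] this is [f (2 * p)], in the real numbers that carry the integrals. *)
Definition central (p : nat) : R := INR (eul (2 * p)%N (S p)) / INR (2 * p)`!.

(** The chosen column has frequency [1] in every even row, so all the integrals share the factor
    [cos t]. *)
Lemma is_lim_seq_central p :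
  is_lim_seq (fun N => sinc_int N (2 * S p).+1 1 - central (S p) * sinc_int N 2 0) 0.
Proof.
have := is_lim_seq_sinc_int (2 * p).+1 (S (S p)).
have -> : 2 * INR (S (S p)) - INR (2 * p).+1 - 2 = 1.
  by rewrite !S_INR mult_INR /=; ring.
by rewrite /central mulnS.
Qed.

Lemma central_convex_large p : (14 <= p)%N ->
  0 <= central p + central (S (S p)) - 2 * central (S p).
Proof.
move=> p14; case: (Rle_or_lt 0 (central p + central (S (S p)) - 2 * central (S p))) => // D0.
set D := central p + _ - _ in D0.
have W N : 0 <= sinc_int (S N) (2 * p).+1 1 + sinc_int (S N) (2 * S (S p)).+1 1
    - 2 * sinc_int (S N) (2 * S p).+1 1.
  have -> : (2 * S (S p)).+1 = ((2 * p).+1 + 4)%N by lia.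
  have -> : (2 * S p).+1 = ((2 * p).+1 + 2)%N by lia.
  rewrite sinc_int_second_diff.
  (* This subtraction is exact because [p >= 14]. *)
  have -> : (2 * p).+1 = ((2 * p - 27) + 28)%N by lia.
  apply: RInt_sinc_weight_ge0; have := PI2_3_2; have := pos_INR N; rewrite S_INR; nra.
pose d k N := sinc_int N (2 * k).+1 1 - central k * sinc_int N 2 0.
have dlim k : (0 < k)%N -> is_lim_seq (d k) 0.
  by case: k => // k _; exact: is_lim_seq_central.
have L : is_lim_seq (fun N => d p (S N) + d (S (S p)) (S N) - 2 * d (S p) (S N)) 0.
  apply/(is_lim_seq_incr_1 (fun N => d p N + d (S (S p)) N - 2 * d (S p) N)).
  have e : 0 + 0 - 2 * 0 = 0 by ring.
  rewrite -[X in is_lim_seq _ (Rbar.Finite X)]e.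
  apply: is_lim_seq_minus'; first by apply: is_lim_seq_plus'; apply: dlim; lia.
  by apply: (is_lim_seq_scal_l _ 2 (Rbar.Finite 0)); apply: dlim.
have [_ G0] := sinc_sq_int_gt0 0.
(* Since [D < 0], the constant is at most [- D * sinc_int (S N) 2 0], hence by [W] at most the
   sequence in [L], which tends to [0]. *)
have /= : Rbar_le (- D * sinc_int 1 2 0) 0.
  apply: is_lim_seq_le (is_lim_seq_const _) L => N.
  have [G1 _] := sinc_sq_int_gt0 N; have := W N.
  rewrite /d; move: G0 G1; set g := sinc_int 1 2 0; set G := sinc_int (S N) 2 0 => G0 G1 WN.
  have : - D * g <= - D * G by nra.
  rewrite /D; lra.
nra.
Qed.

(** [w], [v * w] and [u * (v * w)] stand for the factorials of three consecutive even numbers. *)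
Lemma clear_denominators (a b c u v w : R) : 0 < u -> 0 < v -> 0 < w ->
  0 <= a / w + c / (u * (v * w)) - 2 * (b / (v * w)) ->
  2 * (b * u) <= a * (u * v) + c.
Proof.
move=> u0 v0 w0.
have -> : a / w + c / (u * (v * w)) - 2 * (b / (v * w))
    = (a * (u * v) + c - 2 * (b * u)) * / (u * (v * w)) by field; lra.
have i0 : 0 < / (u * (v * w)).
  by apply: Rinv_0_lt_compat; apply: Rmult_lt_0_compat => //; exact: Rmult_lt_0_compat.
move=> H; have : 0 <= a * (u * v) + c - 2 * (b * u) by apply: Rnot_lt_le => ?; nra.
lra.
Qed.

End EulerianSinc.

(** * Convexity as an inequality of natural numbers, and the small cases *)

Lemma fact_doubleS p :
  ((2 * p.+1)`! = ((2 * p).+2 * (2 * p).+1) * (2 * p)`!)%N.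
Proof. by rewrite mulnS !factS mulnA. Qed.

(* Convexity of [f (2 * _)] at [p.+1], multiplied by [(2 * p.+2)`!]. *)
Definition eul_convex (p : nat) : Prop :=
  (2 * (eul (2 * p.+1) p.+2 * ((2 * p.+1).+2 * (2 * p.+1).+1)) <=
   eul (2 * p) p.+1 * (((2 * p.+1).+2 * (2 * p.+1).+1) * ((2 * p).+2 * (2 * p).+1))
   + eul (2 * p.+2) p.+3)%N.

(** Being about natural numbers, the conclusion can be transferred to any [realType]. *)
Lemma eul_convex_large p : (14 <= p)%N -> eul_convex p.
Proof.
move=> p14; have := central_convex_large p p14.
rewrite /central (fact_doubleS p.+1) (fact_doubleS p) /eul_convex.
set a := eul _ _; set c := eul _ p.+3; set b := eul _ _; set F := (2 * p)`!.
set u := ((2 * p.+1).+2 * _)%N; set v := ((2 * p).+2 * _)%N => H.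
have pos (n : nat) : (0 < n)%N -> Rlt 0 (INR n) by move=> /ltP /lt_0_INR.
have F0 : Rlt 0 (INR F) by apply: pos; exact: fact_gt0.
have u0 : Rlt 0 (INR u) by apply: pos.
have v0 : Rlt 0 (INR v) by apply: pos.
clearbody a b c u v F.
apply/leP/INR_le; rewrite -multE -plusE !(mult_INR, plus_INR).
move: H; rewrite (mult_INR u) (mult_INR v).
exact: clear_denominators.
Qed.

(* Row [m] of the Eulerian triangle in binary, tabulated because [eul] itself
   evaluates in exponential time. *)
Fixpoint eul_row (m : nat) : seq N :=
  if m is m'.+1 then
    let r := eul_row m' in
    mkseq (fun k => N.add (N.mul (N.of_nat k) (nth N0 r k))
                          (N.mul (N.of_nat (m'.+2 - k)) (nth N0 r k.-1))) m'.+3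
  else [:: N0; 1%num].

Lemma nth_eul_row m k : nth N0 (eul_row m) k = N.of_nat (eul m k).
Proof.
elim: m k => [|m IH] k; first by case: k => [|[|k]] //=; rewrite nth_nil.
rewrite [eul_row _]/=; case: (ltnP k m.+3) => km.
  by rewrite nth_mkseq // !IH -!Nnat.Nat2N.inj_mul -Nnat.Nat2N.inj_add.
(* Beyond the row the default [N0] agrees with the vanishing of [eul]. *)
rewrite nth_default ?size_mkseq //.
by case: k km => // k km; rewrite eul_gt //; lia.
Qed.

Definition eul_convexb (p : nat) : bool :=
  N.leb (N.mul 2 (N.mul (nth N0 (eul_row (2 * p.+1)) p.+2)
     (N.mul (N.of_nat (2 * p.+1).+2) (N.of_nat (2 * p.+1).+1))))
  (N.add (N.mul (nth N0 (eul_row (2 * p)) p.+1)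
     (N.mul (N.mul (N.of_nat (2 * p.+1).+2) (N.of_nat (2 * p.+1).+1))
            (N.mul (N.of_nat (2 * p).+2) (N.of_nat (2 * p).+1))))
   (nth N0 (eul_row (2 * p.+2)) p.+3)).

Lemma eul_convexP p : eul_convexb p -> eul_convex p.
Proof.
rewrite /eul_convexb !nth_eul_row (_ : 2%num = N.of_nat 2) //.
rewrite -!Nnat.Nat2N.inj_mul -Nnat.Nat2N.inj_add => /N.leb_le.
by rewrite /eul_convex -!multE -!plusE => H; apply/leP; lia.
Qed.

Lemma eul_convex_ge2 p : (2 <= p)%N -> eul_convex p.
Proof.
move=> p2; case: (leqP 14 p) => p14; first exact: eul_convex_large.
apply: eul_convexP.
have : all eul_convexb (iota 2 12) by vm_compute.
by move/allP; apply; rewrite mem_iota p2.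
Qed.

Import Order.TTheory GRing.Theory Num.Theory.

Theorem proposition4p4 (R : realType) :
  convex_seq 2 (fun p : nat => f R (2 * p)).
Proof.
move=> [|p] // p2; rewrite /f !max_eulerian_even //; last lia.
rewrite (fact_doubleS p.+1) (fact_doubleS p).
have := eul_convex_ge2 p p2; rewrite /eul_convex.
set b := eul _ _; set a := eul _ _; set c := eul _ _; set F := (2 * p)`!.
set u := ((2 * p.+1).+2 * _)%N; set v := ((2 * p).+2 * _)%N => H.
have F0 : (0 < F%:R :> R)%R by rewrite ltr0n fact_gt0.
have u0 : (0 < u%:R :> R)%R by rewrite ltr0n.
have v0 : (0 < v%:R :> R)%R by rewrite ltr0n.
(* Over the common denominator [u * (v * F)] the claim becomes [H]. *)
have uvF : (0 < (u * (v * F))%:R :> R)%R by rewrite !natrM !mulr_gt0.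
have -> : (a%:R / F%:R = (a * (u * v))%:R / (u * (v * F))%:R :> R)%R.
  by rewrite [(u * (v * F))%N]mulnA [(u * v * F)%N]mulnC !(natrM _ _ (u * v)) -mulf_div divff ?mulr1 //
    natrM mulf_neq0 // lt0r_neq0.
have -> : (b%:R / (v * F)%:R = (b * u)%:R / (u * (v * F))%:R :> R)%R.
  by rewrite [(u * (v * F))%N]mulnC !(natrM _ _ u) -mulf_div divff ?mulr1 // lt0r_neq0.
by rewrite mulrA -mulrDl ler_pM2r ?invr_gt0 // -natrD -natrM ler_nat.
Qed.
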